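(* Let $\mathbb{C}$ be a regular category with finite limits and finite colimits, let $V$ be an object of $\mathbb{C}$, let $\Sigma = V + \Sigma' \colon \mathbb{C}\to\mathbb{C}$ where $\Sigma'$ admits free algebras, and let $B\colon \mathbb{C}^{\mathsf{op}}\times\mathbb{C}\to\mathbb{C}$ be a functor. Let $\rho$ be a $V$-pointed higher-order GSOS law of $\Sigma$ over $B$. Suppose that $\Sigma$ preserves reflexive coequalizers and that $B$ preserves monomorphisms (a morphism $(f,g)$ of $\mathbb{C}^{\mathsf{op}}\times\mathbb{C}$ is monic iff $f$ is epic in $\mathbb{C}$ and $g$ is monic in $\mathbb{C}$). Suppose moreover that the endofunctor $B(\mu\Sigma,-)$ has a final coalgebra $(Z,\zeta)$, and let $\mathrm{coit}\,\iota^\clubsuit\colon \mu\Sigma\to Z$ be the unique $B(\mu\Sigma,-)$-coalgebra morphism from the operational model $(\mu\Sigma,\iota^\clubsuit)$. Then the kernel pair of $\mathrm{coit}\,\iota^\clubsuit$ is a congruence.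
   Context: Notation: $\mathrm{inl},\mathrm{inr}$ are coproduct injections, $\nabla\colon A+A\to A$ the codiagonal, $\langle f,g\rangle$ pairing into products. $\Sigma^\star$ denotes the free monad on $\Sigma$, $(\mu\Sigma,\iota)$ the initial $\Sigma$-algebra; for a $\Sigma$-algebra $(A,a)$, $(\!|a|\!)\colon\mu\Sigma\to A$ is the unique algebra morphism and $\hat a\colon\Sigma^\star A\to A$ is the unique $\Sigma$-algebra morphism from the free algebra $\Sigma^\star A$ extending $\mathrm{id}_A$. $V/\mathbb{C}$ is the coslice category (objects: pairs $(X,p_X\colon V\to X)$; morphisms $h$ with $h\circ p_X=p_Y$), and $j\colon V/\mathbb{C}\to\mathbb{C}$ is the forgetful functor. Every $\Sigma$-algebra $(A,a)$ is regarded as a $V$-pointed object via $V\xrightarrow{\mathrm{inl}} V+\Sigma'A=\Sigma A\xrightarrow{a}A$. A $V$-pointed higher-order GSOS law of $\Sigma$ over $B$ is a family of morphisms $\rho_{X,Y}\colon \Sigma(jX\times B(jX,Y))\to B(jX,\Sigma^\star(jX+Y))$ that is dinatural in $X\in V/\mathbb{C}$ and natural in $Y\in\mathbb{C}$. For every $\Sigma$-algebra $(A,a)$ there is a unique morphism $a^\clubsuit\colon\mu\Sigma\to B(A,A)$ with $a^\clubsuit\circ\iota = B(\mathrm{id},\hat a)\circ B(\mathrm{id},\Sigma^\star\nabla)\circ\rho_{A,A}\circ\Sigma\langle (\!|a|\!),a^\clubsuit\rangle$; the operational model is $\iota^\clubsuit\colon\mu\Sigma\to B(\mu\Sigma,\mu\Sigma)$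 (the case $(A,a)=(\mu\Sigma,\iota)$). The kernel pair $p_1,p_2\colon E\to\mu\Sigma$ of a morphism $f\colon\mu\Sigma\to Z$ is its pullback along itself; it is called a congruence if the coequalizer $q\colon\mu\Sigma\to Q$ of $p_1,p_2$ admits a $\Sigma$-algebra structure $a\colon\Sigma Q\to Q$ such that $q$ is a $\Sigma$-algebra morphism from $(\mu\Sigma,\iota)$ to $(Q,a)$. A regular category is one with finite limits, coequalizers of kernel pairs, and pullback-stable regular epimorphisms. *)

(* Defs.v *)
From Stdlib Require Import List ProofIrrelevance IndefiniteDescription.

Set Implicit Arguments.
Unset Strict Implicit.
Unset Printing Implicit Defensive.

Declare Scope cat_scope.
Delimit Scope cat_scope with cat.
Open Scope cat_scope.

Record Category : Type := MkCategory {
  ob :> Type;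
  hom : ob -> ob -> Type;
  idm : forall X, hom X X;
  comp : forall X Y Z, hom Y Z -> hom X Y -> hom X Z;
  comp_idl : forall X Y (f : hom X Y), comp (idm Y) f = f;
  comp_idr : forall X Y (f : hom X Y), comp f (idm X) = f;
  comp_assoc : forall W X Y Z (h : hom Y Z) (g : hom X Y) (f : hom W X),
    comp h (comp g f) = comp (comp h g) f
}.
Arguments hom {c} X Y.
Arguments idm {c} X.
Arguments comp {c X Y Z} g f : rename.

Notation "X ~> Y" := (hom X Y) (at level 90, right associativity) : cat_scope.
Notation "g ∘ f" := (comp g f) (at level 40, left associativity) : cat_scope.

Record Functor (C D : Category) : Type := MkFunctor {
  fob :> C -> D;
  fmap : forall X Y : C, (X ~> Y) -> (fob X ~> fob Y);
  fmap_id : forall X, fmap (idm X) = idm (fob X);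
  fmap_comp : forall X Y Z (g : Y ~> Z) (f : X ~> Y),
    fmap (g ∘ f) = fmap g ∘ fmap f
}.
Arguments fmap {C D} F {X Y} f : rename.

Definition op (C : Category) : Category :=
  @MkCategory (ob C) (fun X Y => @hom C Y X) (fun X => idm X)
    (fun X Y Z g f => @comp C Z Y X f g)
    (fun X Y f => comp_idr f)
    (fun X Y f => comp_idl f)
    (fun W X Y Z h g f => eq_sym (comp_assoc f g h)).

Program Definition prod_cat (C D : Category) : Category :=
  @MkCategory (ob C * ob D)
    (fun X Y => ((fst X ~> fst Y) * (snd X ~> snd Y))%type)
    (fun X => (idm (fst X), idm (snd X)))
    (fun X Y Z g f => (fst g ∘ fst f, snd g ∘ snd f)) _ _ _.
Next Obligation. now rewrite !comp_idl. Qed.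
Next Obligation. now rewrite !comp_idr. Qed.
Next Obligation. now rewrite !comp_assoc. Qed.

Record PointedObject (C : Category) (V : C) : Type := Pointed {
  pt_ob : C;
  pt : V ~> pt_ob
}.
Arguments Pointed {C V} pt_ob pt.

Lemma coslice_comp (C : Category) (V X Y Z : C) (x : V ~> X) (y : V ~> Y)
    (z : V ~> Z) (g : Y ~> Z) (f : X ~> Y) :
  g ∘ y = z -> f ∘ x = y -> (g ∘ f) ∘ x = z.
Proof. intros <- <-; symmetry; apply comp_assoc. Qed.

Program Definition coslice (C : Category) (V : C) : Category :=
  @MkCategory (PointedObject V)
    (fun X Y => {h : pt_ob X ~> pt_ob Y | h ∘ pt X = pt Y})
    (fun X => exist _ (idm (pt_ob X)) (comp_idl (pt X)))
    (fun X Y Z g f => exist _ (proj1_sig g ∘ proj1_sig f)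
      (coslice_comp (proj2_sig g) (proj2_sig f))) _ _ _.
Next Obligation. apply subset_eq_compat, comp_idl. Qed.
Next Obligation. apply subset_eq_compat, comp_idr. Qed.
Next Obligation. apply subset_eq_compat, comp_assoc. Qed.

Definition forget (C : Category) (V : C) : Functor (coslice V) C :=
  @MkFunctor (coslice V) C (fun X => pt_ob X) (fun X Y h => proj1_sig h)
    (fun X => eq_refl) (fun X Y Z g f => eq_refl).

Definition finite_type (T : Type) : Prop :=
  exists l : list T, forall x, In x l.

Definition finite_category (J : Category) : Prop :=
  finite_type J /\ forall i j : J, finite_type (i ~> j).

Section Limits.
Variables (J C : Category) (D : Functor J C).

Definition is_cone (L : C) (p : forall i, L ~> D i) : Prop :=
  forall (i j : J) (u : i ~> j), fmap D u ∘ p i = p j.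

Definition is_limit (L : C) (p : forall i, L ~> D i) : Prop :=
  is_cone p /\
  forall (W : C) (t : forall i, W ~> D i), is_cone t ->
    exists! k : W ~> L, forall i, p i ∘ k = t i.

Definition is_cocone (L : C) (c : forall i, D i ~> L) : Prop :=
  forall (i j : J) (u : i ~> j), c j ∘ fmap D u = c i.

Definition is_colimit (L : C) (c : forall i, D i ~> L) : Prop :=
  is_cocone c /\
  forall (W : C) (t : forall i, D i ~> W), is_cocone t ->
    exists! k : L ~> W, forall i, k ∘ c i = t i.
End Limits.

Definition has_finite_limits (C : Category) : Prop :=
  forall J : Category, finite_category J -> forall D : Functor J C,
    exists (L : C) (p : forall i, L ~> D i), is_limit p.

Definition has_finite_colimits (C : Category) : Prop :=
  forall J : Category, finite_category J -> forall D : Functor J C,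
    exists (L : C) (c : forall i, D i ~> L), is_colimit c.

Section Morphisms.
Variable C : Category.

Definition monic (X Y : C) (f : X ~> Y) : Prop :=
  forall (W : C) (u v : W ~> X), f ∘ u = f ∘ v -> u = v.

Definition is_pullback (X Y Z P : C) (f : X ~> Z) (g : Y ~> Z)
    (p1 : P ~> X) (p2 : P ~> Y) : Prop :=
  f ∘ p1 = g ∘ p2 /\
  forall (W : C) (u : W ~> X) (v : W ~> Y), f ∘ u = g ∘ v ->
    exists! k : W ~> P, p1 ∘ k = u /\ p2 ∘ k = v.

Definition is_kernel_pair (X Y E : C) (f : X ~> Y) (p1 p2 : E ~> X) : Prop :=
  is_pullback f f p1 p2.

Definition is_coequalizer (X Y Q : C) (f g : X ~> Y) (q : Y ~> Q) : Prop :=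
  q ∘ f = q ∘ g /\
  forall (W : C) (h : Y ~> W), h ∘ f = h ∘ g ->
    exists! k : Q ~> W, k ∘ q = h.

Definition regular_epi (Y Q : C) (q : Y ~> Q) : Prop :=
  exists (X : C) (f g : X ~> Y), is_coequalizer f g q.

Definition reflexive_pair (X Y : C) (f g : X ~> Y) : Prop :=
  exists s : Y ~> X, f ∘ s = idm Y /\ g ∘ s = idm Y.
End Morphisms.

Definition epic (C : Category) (X Y : C) (f : X ~> Y) : Prop :=
  forall (W : C) (u v : Y ~> W), u ∘ f = v ∘ f -> u = v.

Lemma monic_op_prod (C : Category) (X X' Y Y' : C) (f : X' ~> X) (g : Y ~> Y') :
  @monic (prod_cat (op C) C) (X, Y) (X', Y') (f, g) <-> epic f /\ monic g.
Proof.
  split.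
  - intros H; split.
    + intros W u v e.
      assert (K : (u, idm Y) = (v, idm Y)).
      { apply (H (W, Y)); simpl; now rewrite e. }
      now injection K.
    + intros W u v e.
      assert (K : (idm X, u) = (idm X, v)).
      { apply (H (X, W)); simpl; now rewrite e. }
      now injection K.
  - intros [Hf Hg] [W1 W2] [u1 u2] [v1 v2] e; simpl in *.
    injection e as e1 e2; f_equal; [now apply Hf | now apply Hg].
Qed.

Record regular_category (C : Category) : Prop := {
  regular_finite_limits : has_finite_limits C;
  regular_coequalizers : forall (X Y E : C) (f : X ~> Y) (p1 p2 : E ~> X),
    is_kernel_pair f p1 p2 ->
    exists (Q : C) (q : X ~> Q), is_coequalizer p1 p2 q;
  regular_epi_stable :
    forall (X Y Z P : C) (f : X ~> Z) (g : Y ~> Z) (p1 : P ~> X) (p2 : P ~> Y),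
    is_pullback f g p1 p2 -> regular_epi f -> regular_epi p2
}.

Definition preserves_monos (C D : Category) (F : Functor C D) : Prop :=
  forall (X Y : C) (f : X ~> Y), monic f -> monic (fmap F f).

Definition preserves_reflexive_coequalizers (C D : Category) (F : Functor C D)
    : Prop :=
  forall (X Y Q : C) (f g : X ~> Y) (q : Y ~> Q),
    reflexive_pair f g -> is_coequalizer f g q ->
    is_coequalizer (fmap F f) (fmap F g) (fmap F q).

Class BinaryProducts (C : Category) : Type := {
  bprod : C -> C -> C;
  pr1 : forall X Y, bprod X Y ~> X;
  pr2 : forall X Y, bprod X Y ~> Y;
  pairing : forall W X Y, (W ~> X) -> (W ~> Y) -> (W ~> bprod X Y);
  pr1_pairing : forall W X Y (f : W ~> X) (g : W ~> Y),
    pr1 X Y ∘ pairing f g = f;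
  pr2_pairing : forall W X Y (f : W ~> X) (g : W ~> Y),
    pr2 X Y ∘ pairing f g = g;
  pairing_unique : forall W X Y (f : W ~> X) (g : W ~> Y) (h : W ~> bprod X Y),
    pr1 X Y ∘ h = f -> pr2 X Y ∘ h = g -> h = pairing f g
}.
Arguments pr1 {C _ X Y}.
Arguments pr2 {C _ X Y}.

Class BinaryCoproducts (C : Category) : Type := {
  bsum : C -> C -> C;
  inl : forall X Y, X ~> bsum X Y;
  inr : forall X Y, Y ~> bsum X Y;
  copairing : forall X Y W, (X ~> W) -> (Y ~> W) -> (bsum X Y ~> W);
  copairing_inl : forall X Y W (f : X ~> W) (g : Y ~> W),
    copairing f g ∘ inl X Y = f;
  copairing_inr : forall X Y W (f : X ~> W) (g : Y ~> W),
    copairing f g ∘ inr X Y = g;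
  copairing_unique : forall X Y W (f : X ~> W) (g : Y ~> W) (h : bsum X Y ~> W),
    h ∘ inl X Y = f -> h ∘ inr X Y = g -> h = copairing f g
}.
Arguments inl {C _ X Y}.
Arguments inr {C _ X Y}.

Notation "X × Y" := (bprod X Y) (at level 40, left associativity) : cat_scope.
Notation "X + Y" := (bsum X Y) (at level 50, left associativity) : cat_scope.

Definition prod_map (C : Category) {prodC : BinaryProducts C} (X X' Y Y' : C)
    (f : X ~> X') (g : Y ~> Y') : X × Y ~> X' × Y' :=
  pairing (f ∘ pr1) (g ∘ pr2).

Definition sum_map (C : Category) {sumC : BinaryCoproducts C} (X X' Y Y' : C)
    (f : X ~> X') (g : Y ~> Y') : X + Y ~> X' + Y' :=
  copairing (inl ∘ f) (inr ∘ g).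

Definition codiag (C : Category) {sumC : BinaryCoproducts C} (X : C)
    : X + X ~> X :=
  copairing (idm X) (idm X).

Program Definition plus_functor (C : Category) {sumC : BinaryCoproducts C}
    (V : C) (Sigma' : Functor C C) : Functor C C :=
  @MkFunctor C C (fun X => V + Sigma' X)
    (fun X Y f => sum_map (idm V) (fmap Sigma' f)) _ _.
Next Obligation.
  symmetry; apply copairing_unique; now rewrite ?fmap_id, comp_idl, comp_idr.
Qed.
Next Obligation.
  symmetry; apply copairing_unique; unfold sum_map; rewrite <- comp_assoc.
  - now rewrite copairing_inl, comp_assoc, copairing_inl, comp_idr.
  - rewrite copairing_inr, comp_assoc, copairing_inr.
    now rewrite fmap_comp, comp_assoc.
Qed.

Section Algebras.
Variables (C : Category) (F : Functor C C).

Record Algebra : Type := MkAlgebra {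
  carrier :> C;
  structure : F carrier ~> carrier
}.

Definition is_algebra_morphism (A B : Algebra) (h : A ~> B) : Prop :=
  h ∘ structure A = structure B ∘ fmap F h.
Arguments is_algebra_morphism : clear implicits.

Record InitialAlgebra : Type := MkInitialAlgebra {
  initial_alg :> Algebra;
  fold : forall A : Algebra, initial_alg ~> A;
  fold_morphism : forall A, is_algebra_morphism initial_alg A (fold A);
  fold_unique : forall (A : Algebra) (h : initial_alg ~> A),
    is_algebra_morphism initial_alg A h -> h = fold A
}.

Record FreeAlgebra (X : C) : Type := MkFreeAlgebra {
  free_alg :> Algebra;
  eta : X ~> free_alg;
  ext : forall A : Algebra, (X ~> A) -> (free_alg ~> A);
  ext_morphism : forall (A : Algebra) (f : X ~> A),
    is_algebra_morphism free_alg A (ext f);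
  ext_eta : forall (A : Algebra) (f : X ~> A), ext f ∘ eta = f;
  ext_unique : forall (A : Algebra) (f : X ~> A) (h : free_alg ~> A),
    is_algebra_morphism free_alg A h -> h ∘ eta = f -> h = ext f
}.

Definition admits_free_algebras : Prop :=
  forall X : C, inhabited (FreeAlgebra X).

Definition FreeAlgebras : Type := forall X : C, FreeAlgebra X.

Definition is_coalgebra_morphism (X Y : C) (c : X ~> F X) (d : Y ~> F Y)
    (h : X ~> Y) : Prop :=
  d ∘ h = fmap F h ∘ c.

Record FinalCoalgebra : Type := MkFinalCoalgebra {
  final_ob :> C;
  final_str : final_ob ~> F final_ob;
  coit : forall X : C, (X ~> F X) -> (X ~> final_ob);
  coit_morphism : forall X (c : X ~> F X),
    is_coalgebra_morphism c final_str (coit c);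
  coit_unique : forall X (c : X ~> F X) (h : X ~> final_ob),
    is_coalgebra_morphism c final_str h -> h = coit c
}.

End Algebras.
Arguments is_algebra_morphism {C F} A B h : rename.
Arguments structure {C F} A : rename.
Arguments fold {C F} i A : rename.
Arguments eta {C F X} T : rename.
Arguments ext {C F X} T {A} f : rename.
Arguments final_str {C F} Z : rename.
Arguments coit {C F} Z {X} c : rename.

(* The free monad on [F] is the one induced by the chosen free algebras;
   only the underlying functor is needed here. *)
Definition star_ob (C : Category) (F : Functor C C) (star : FreeAlgebras F)
    (X : C) : C :=
  star X.

Definition star_map (C : Category) (F : Functor C C) (star : FreeAlgebras F)
    (X Y : C) (f : X ~> Y) : star_ob star X ~> star_ob star Y :=
  ext (star X) (A := star Y) (eta (star Y) ∘ f).

Definition hat (C : Category) (F : Functor C C) (star : FreeAlgebras F)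
    (A : Algebra F) : star_ob star A ~> A :=
  ext (star A) (idm A).

Definition MixedBifunctor (C : Category) : Type :=
  Functor (prod_cat (op C) C) C.

Definition bob (C : Category) (B : MixedBifunctor C) (X Y : C) : C :=
  fob B (X, Y).

Definition bmap (C : Category) (B : MixedBifunctor C) (X X' Y Y' : C)
    (f : X' ~> X) (g : Y ~> Y') : bob B X Y ~> bob B X' Y' :=
  @fmap (prod_cat (op C) C) C B (X, Y) (X', Y') (f, g).

Program Definition fix_left (C : Category) (B : MixedBifunctor C) (X : C)
    : Functor C C :=
  @MkFunctor C C (fun Y => bob B X Y) (fun Y Y' g => bmap B (idm X) g) _ _.
Next Obligation. exact (fmap_id B (X, X0)). Qed.
Next Obligation.
  unfold bmap; rewrite <- (comp_idl (idm X)) at 1.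
  exact (@fmap_comp _ _ B (X, X0) (X, Y) (X, Z) (idm X, g) (idm X, f)).
Qed.

Section HigherOrderGSOS.
Variables (C : Category) (prodC : BinaryProducts C) (sumC : BinaryCoproducts C).
Variables (V : C) (Sigma' : Functor C C).
Let Sigma : Functor C C := plus_functor V Sigma'.
Variables (star : FreeAlgebras Sigma) (B : MixedBifunctor C).
Let j : Functor (coslice V) C := forget V.

Record HOGSOSLaw : Type := MkHOGSOSLaw {
  rho : forall (X : coslice V) (Y : C),
    Sigma (j X × bob B (j X) Y) ~> bob B (j X) (star_ob star (j X + Y));
  rho_dinatural : forall (X X' : coslice V) (h : X ~> X') (Y : C),
    bmap B (idm (j X)) (star_map star (sum_map (fmap j h) (idm Y)))
      ∘ rho X Y
      ∘ fmap Sigma (prod_map (idm (j X)) (bmap B (fmap j h) (idm Y)))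
    = bmap B (fmap j h) (idm (star_ob star (j X' + Y)))
      ∘ rho X' Y
      ∘ fmap Sigma (prod_map (fmap j h) (idm (bob B (j X') Y)));
  rho_natural : forall (X : coslice V) (Y Y' : C) (g : Y ~> Y'),
    bmap B (idm (j X)) (star_map star (sum_map (idm (j X)) g)) ∘ rho X Y
    = rho X Y'
      ∘ fmap Sigma (prod_map (idm (j X)) (bmap B (idm (j X)) g))
}.

Definition pointed_algebra (A : Algebra Sigma) : coslice V :=
  Pointed (carrier A) (structure A ∘ inl).

Definition is_clubsuit (law : HOGSOSLaw) (mu : InitialAlgebra Sigma)
    (A : Algebra Sigma) (club : mu ~> bob B A A) : Prop :=
  club ∘ structure mu
  = bmap B (idm (carrier A)) (hat star A)
    ∘ bmap B (idm (carrier A)) (star_map star (codiag A))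
    ∘ rho law (pointed_algebra A) A
    ∘ fmap Sigma (pairing (fold mu A) club).

Definition is_operational_model (law : HOGSOSLaw) (mu : InitialAlgebra Sigma)
    (gamma : mu ~> bob B mu mu) : Prop :=
  is_clubsuit law (A := mu) gamma.

End HigherOrderGSOS.

(* Coequalizers being unique up to isomorphism, it is immaterial which
   coequalizer [q] carries the algebra structure. *)
Definition is_congruence (C : Category) (F : Functor C C)
    (mu : InitialAlgebra F) (E : C) (p1 p2 : E ~> mu) : Prop :=
  exists (Q : C) (q : mu ~> Q), is_coequalizer p1 p2 q /\
  exists a : F Q ~> Q, is_algebra_morphism mu (MkAlgebra a) q.

Lemma initial_algebra_exists (C : Category) (F : Functor C C) :
  has_finite_colimits C -> admits_free_algebras F -> inhabited (InitialAlgebra F).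
Proof.
  intros HC HF.
  unshelve epose (J := @MkCategory Empty_set (fun _ _ => Empty_set)
    (fun i => i) (fun _ _ _ g _ => g) _ _ _); try (intros x; destruct x).
  assert (HJ : finite_category J).
  { split; [exists nil; intros x; destruct x | intros i; destruct i]. }
  assert (D : Functor J C).
  { unshelve eapply (@MkFunctor J C); intros x; destruct x. }
  destruct (HC J HJ D) as (O & c & _ & HO).
  assert (HO' : forall W : C, exists! k : O ~> W, True).
  { intros W; assert (t : forall i : J, D i ~> W) by (intros x; destruct x).
    destruct (HO W t) as (k & _ & Hk).
    - intros x; destruct x.
    - exists k; split; [exact I | intros k' _; apply Hk; intros x; destruct x]. }
  destruct (HF O) as [T].
  set (k := fun A : Algebra F => proj1_sig (constructive_indefinite_description _ (HO' A))).
  assert (Hk : forall (A : Algebra F) (h : O ~> A), h = k A).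
  { intros A h; unfold k.
    destruct (constructive_indefinite_description _ (HO' A)) as (k' & ? & Hk').
    simpl; symmetry; now apply Hk'. }
  constructor.
  refine (@MkInitialAlgebra C F T (fun A => ext T (k A)) _ _).
  - intros A; apply ext_morphism.
  - intros A h Hh; apply ext_unique; [exact Hh | apply Hk].
Qed.

Section Existence.
Variables (C : Category) (prodC : BinaryProducts C) (sumC : BinaryCoproducts C).
Variables (V : C) (Sigma' : Functor C C).
Let Sigma : Functor C C := plus_functor V Sigma'.

Lemma plus_admits_free_algebras :
  admits_free_algebras Sigma' -> admits_free_algebras Sigma.
Proof.
  intros H X; destruct (H (V + X)) as [T].
  set (under := fun A : Algebra Sigma => @MkAlgebra C Sigma' A (structure A ∘ inr)).
  set (S := @MkAlgebra C Sigma T (copairing (eta T ∘ inl) (structure T))).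
  assert (HS : forall (A : Algebra Sigma) (h : S ~> A),
    is_algebra_morphism S A h <->
    h ∘ eta T ∘ inl = structure A ∘ inl /\
    is_algebra_morphism T (under A) h).
  { intros A h; unfold is_algebra_morphism; simpl; unfold sum_map; split.
    - intros e; split.
      + pose proof (f_equal (fun k => k ∘ inl) e) as e1; simpl in e1.
        rewrite <- !comp_assoc, !copairing_inl, comp_idr in e1.
        now rewrite <- comp_assoc.
      + pose proof (f_equal (fun k => k ∘ inr) e) as e1; simpl in e1.
        rewrite <- !comp_assoc, !copairing_inr in e1.
        now rewrite <- comp_assoc.
    - intros [e1 e2].
      rewrite (copairing_unique (f := structure A ∘ inl)
        (g := structure A ∘ inr ∘ fmap Sigma' h)
        (h := h ∘ copairing (eta T ∘ inl) (structure T))).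
      + symmetry; apply copairing_unique; rewrite <- comp_assoc.
        * now rewrite copairing_inl, comp_idr.
        * now rewrite copairing_inr, comp_assoc.
      + now rewrite <- comp_assoc, copairing_inl, comp_assoc.
      + now rewrite <- comp_assoc, copairing_inr. }
  constructor.
  unshelve refine (@MkFreeAlgebra C Sigma X S (eta T ∘ inr)
    (fun A f => ext T (A := under A) (copairing (structure A ∘ inl) f)) _ _ _).
  - intros A f; apply HS; split; [|apply (ext_morphism T (A := under A))].
    etransitivity; [|apply copairing_inl].
    apply (f_equal (fun k => k ∘ inl)), (ext_eta T (A := under A)).
  - intros A f; rewrite comp_assoc; etransitivity; [|apply copairing_inr].
    apply (f_equal (fun k => k ∘ inr)), (ext_eta T (A := under A)).
  - intros A f h Hh e; apply HS in Hh; destruct Hh as [e1 e2].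
    apply (ext_unique (A := under A)); [exact e2|].
    apply copairing_unique; [exact e1|]. now rewrite <- comp_assoc.
Qed.

Lemma clubsuit_exists_unique (star : FreeAlgebras Sigma) (B : MixedBifunctor C)
    (law : HOGSOSLaw prodC star B) (mu : InitialAlgebra Sigma)
    (A : Algebra Sigma) :
  exists! club : mu ~> bob B A A, is_clubsuit law club.
Proof.
  set (r := bmap B (idm (carrier A)) (hat star A)
    ∘ bmap B (idm (carrier A)) (star_map star (codiag A))
    ∘ rho law (pointed_algebra A) A).
  set (P := @MkAlgebra C Sigma (A × bob B A A)
    (pairing (structure A ∘ fmap Sigma pr1) r)).
  assert (HP : forall c : mu ~> bob B A A,
    is_clubsuit law c <-> pairing (fold mu A) c = fold mu P).
  { intros c; split.
    - intros e; apply (fold_unique (A := P)).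
      unfold is_algebra_morphism, P; cbn [structure carrier].
      transitivity (pairing (structure A ∘ fmap Sigma (fold mu A))
        (r ∘ fmap Sigma (pairing (fold mu A) c))).
      + apply pairing_unique; rewrite comp_assoc.
        * rewrite pr1_pairing; apply fold_morphism.
        * rewrite pr2_pairing; exact e.
      + symmetry; apply pairing_unique; rewrite comp_assoc.
        * now rewrite pr1_pairing, <- comp_assoc, <- fmap_comp, pr1_pairing.
        * now rewrite pr2_pairing.
    - intros e; unfold is_clubsuit; fold r.
      pose proof (fold_morphism mu P) as m.
      rewrite <- e in m; unfold is_algebra_morphism, P in m.
      cbn [structure carrier] in m.
      apply (f_equal (fun k => pr2 ∘ k)) in m; rewrite !comp_assoc in m.
      now rewrite !pr2_pairing in m. }
  set (t := fold mu P : mu ~> A × bob B A A).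
  assert (Ht : t ∘ structure mu
      = pairing (structure A ∘ fmap Sigma pr1) r ∘ fmap Sigma t)
    by exact (fold_morphism mu P).
  assert (H1 : pr1 ∘ t = fold mu A).
  { apply (fold_unique (A := A)); unfold is_algebra_morphism.
    now rewrite <- comp_assoc, Ht, comp_assoc, pr1_pairing, fmap_comp, comp_assoc. }
  exists (pr2 ∘ t); split.
  - apply HP; symmetry; now apply pairing_unique.
  - intros c e; apply HP in e; fold t in e; now rewrite <- e, pr2_pairing.
Qed.

End Existence.

(* Main.v *)
Require Import Defs.

Set Implicit Arguments.
Unset Strict Implicit.
Unset Printing Implicit Defensive.

(** Write [f = coit Z iota_club].  Extend the two projections of its kernel
    pair [E] to algebra morphisms [Σ⋆E ~> μΣ]; their coequalizer
    [c : μΣ ~> A] exists, is reflexive, and so makes [A] an algebra [(A,a)]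
    with [c] the fold.  Dinaturality of [ρ] gives
    [B(id,c) ∘ ι♣ = B(c,id) ∘ a♣].  On generators, [a♣] identifies the two
    projections because [f] does, the mono part of [f] and [B(c,id)] being
    monic after applying [B]; by primitive recursion [a♣] identifies the two
    extended projections.  Hence [A] is a quotient coalgebra of the operational
    model and [f] factors through [c], which says that [E] is closed under the
    operations. *)

(** * Coequalizers and pullbacks as finite colimits and limits *)

(** The object [false] is the source of the pair and [true] its target; the two booleans in the hom
    between them are the parallel arrows. *)
Definition parallel_hom (i j : bool) : Type :=
  match i, j with
  | false, true => bool
  | true, false => Empty_set
  | _, _ => unit
  end.

Definition parallel_category : Category.
Proof.
  unshelve refine (@MkCategory bool parallel_hom
    (fun i => match i with true => tt | false => tt end)
    (fun i j k => match i, j, k with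
      | false, false, false | true, true, true => fun _ _ => tt
      | false, false, true => fun g _ => g
      | false, true, true => fun _ f => f
      | false, true, false => fun g _ => match g with end
      | true, false, _ => fun _ f => match f with end
      | true, true, false => fun g _ => g
      end) _ _ _).
  - intros [] [] []; reflexivity.
  - intros [] [] []; reflexivity.
  - intros [] [] [] [] [] [] []; reflexivity.
Defined.

Lemma parallel_category_finite : finite_category parallel_category.
Proof.
  split.
  - exists (true :: false :: nil)%list; intros []; simpl; auto.
  - intros [] [].
    + exists (tt :: nil)%list; intros []; simpl; auto.
    + exists nil; intros [].
    + exists (true :: false :: nil)%list; intros []; simpl; auto.
    + exists (tt :: nil)%list; intros []; simpl; auto.
Qed.

Definition parallel_functor (C : Category) (X Y : C) (f g : X ~> Y) :
  Functor parallel_category C.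
Proof.
  unshelve refine (@MkFunctor parallel_category C
    (fun i => if i then Y else X)
    (fun i j => match i, j return parallel_hom i j ->
        ((if i then Y else X) ~> (if j then Y else X)) with
      | false, true => fun b => if b then f else g
      | true, false => fun e => match e with end
      | true, true => fun _ => idm Y
      | false, false => fun _ => idm X
      end) _ _).
  - intros []; reflexivity.
  - intros [] [] [] [] []; simpl; now rewrite ?comp_idl, ?comp_idr.
Defined.

Lemma coequalizer_exists (C : Category) (X Y : C) (f g : X ~> Y) :
  has_finite_colimits C -> exists (Q : C) (q : Y ~> Q), is_coequalizer f g q.
Proof.
  intros HC.
  destruct (HC _ parallel_category_finite (parallel_functor f g))
    as (Q & c & Hc & Hu).
  pose proof (Hc false true true) as ef; pose proof (Hc false true false) as eg.
  simpl in ef, eg.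
  exists Q, (c true); split; [now rewrite ef, eg|].
  intros W h e.
  destruct (Hu W (fun i => match i return parallel_functor f g i ~> W with
      true => h | false => h ∘ f end)) as (k & Hk & Hk').
  - intros [] [] []; simpl; now rewrite ?comp_idr.
  - exists k; split; [exact (Hk true)|].
    intros k' e'; apply Hk'; intros []; simpl; [exact e'|].
    now rewrite <- e', <- comp_assoc, <- ef.
Qed.

(* [None] is the apex of the cospan. *)
Definition cospan_hom (i j : option bool) : Type :=
  match i, j with
  | _, None | Some true, Some true | Some false, Some false => unit
  | _, _ => Empty_set
  end.

Definition cospan_category : Category.
Proof.
  unshelve refine (@MkCategory (option bool) cospan_hom _ _ _ _ _).
  - intros [[]|]; exact tt.
  - intros [[]|] [[]|] [[]|] [] []; exact tt.
  - intros [[]|] [[]|] []; reflexivity.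
  - intros [[]|] [[]|] []; reflexivity.
  - intros [[]|] [[]|] [[]|] [[]|] [] [] []; reflexivity.
Defined.

Lemma cospan_category_finite : finite_category cospan_category.
Proof.
  split.
  - exists (Some true :: Some false :: None :: nil)%list.
    intros [[]|]; simpl; auto.
  - intros [[]|] [[]|];
      solve [exists nil; intros [] | exists (tt :: nil)%list; intros []; simpl; auto].
Qed.

Definition cospan_functor (C : Category) (X Y Z : C) (f : X ~> Z) (g : Y ~> Z) :
  Functor cospan_category C.
Proof.
  unshelve refine (@MkFunctor cospan_category C
    (fun i => match i with Some true => X | Some false => Y | None => Z end)
    _ _ _).
  - intros [[]|] [[]|] [];
      [exact (idm X) | exact f | exact (idm Y) | exact g | exact (idm Z)].
  - intros [[]|]; reflexivity.
  - intros [[]|] [[]|] [[]|] [] []; simpl; now rewrite ?comp_idl, ?comp_idr.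
Defined.

Lemma pullback_exists (C : Category) (X Y Z : C) (f : X ~> Z) (g : Y ~> Z) :
  has_finite_limits C ->
  exists (P : C) (p1 : P ~> X) (p2 : P ~> Y), is_pullback f g p1 p2.
Proof.
  intros HC.
  destruct (HC _ cospan_category_finite (cospan_functor f g))
    as (P & p & Hp & Hu).
  pose proof (Hp (Some true) None tt) as ef.
  pose proof (Hp (Some false) None tt) as eg.
  simpl in ef, eg.
  exists P, (p (Some true)), (p (Some false)); split; [now rewrite ef, eg|].
  intros W u v e.
  destruct (Hu W (fun i => match i return W ~> cospan_functor f g i with
      | Some true => u | Some false => v | None => f ∘ u end))
    as (k & Hk & Hk').
  - intros [[]|] [[]|] []; simpl; now rewrite ?comp_idl.
  - exists k; split; [split; [exact (Hk (Some true)) | exact (Hk (Some false))]|].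
    intros k' [e1 e2]; apply Hk'; intros [[]|]; simpl; [exact e1 | exact e2|].
    now rewrite <- e1, comp_assoc, <- ef.
Qed.

(** * Regular epimorphisms and kernel pairs *)

Lemma coequalizer_epic (C : Category) (X Y Q : C) (f g : X ~> Y) (q : Y ~> Q) :
  is_coequalizer f g q -> epic q.
Proof.
  intros [e Hq] W u v euv.
  destruct (Hq W (u ∘ q)) as (k & _ & Hk).
  - now rewrite <- !comp_assoc, e.
  - now rewrite <- (Hk u eq_refl), <- (Hk v (eq_sym euv)).
Qed.

Lemma regular_epi_epic (C : Category) (Y Q : C) (q : Y ~> Q) :
  regular_epi q -> epic q.
Proof. intros (X & f & g & H); exact (coequalizer_epic H). Qed.

(** The common section is the diagonal induced by the pair of identities. *)
Lemma kernel_pair_reflexive (C : Category) (X Y E : C) (f : X ~> Y)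
    (p1 p2 : E ~> X) : is_kernel_pair f p1 p2 -> reflexive_pair p1 p2.
Proof.
  intros [_ H]; destruct (H X (idm X) (idm X) eq_refl) as (s & Hs & _).
  now exists s.
Qed.

(* Two generalized elements of [Q] are covered, after two pullbacks of [q], by
   generalized elements of [X]; equality under [m] puts these in [E]. *)
Lemma kernel_quotient_monic (C : Category) (C_regular : regular_category C)
    (X Y E Q : C) (f : X ~> Y) (p1 p2 : E ~> X) (q : X ~> Q) (m : Q ~> Y) :
  is_kernel_pair f p1 p2 -> is_coequalizer p1 p2 q -> m ∘ q = f -> monic m.
Proof.
  intros [_ HE] Hq em W u v e.
  assert (Rq : regular_epi q) by now exists E, p1, p2.
  destruct (pullback_exists q u (regular_finite_limits C_regular))
    as (P & x & a & HP).
  destruct (pullback_exists q (v ∘ a) (regular_finite_limits C_regular))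
    as (P' & y & b & HP').
  assert (epi_a : epic a)
    by exact (regular_epi_epic (regular_epi_stable C_regular HP Rq)).
  assert (epi_b : epic b)
    by exact (regular_epi_epic (regular_epi_stable C_regular HP' Rq)).
  destruct HP as [ex _], HP' as [ey _].
  apply epi_a, epi_b.
  destruct (HE P' (x ∘ b) y) as (k & [k1 k2] & _).
  - rewrite <- em, <- !comp_assoc, ey, (comp_assoc q x b), ex.
    now rewrite !comp_assoc, e.
  - rewrite <- ex, <- ey, <- comp_assoc, <- k1, <- k2, !comp_assoc.
    now rewrite (proj1 Hq).
Qed.

(** * Free algebras and primitive recursion *)

Lemma pairing_comp (C : Category) (prodC : BinaryProducts C) (W W' X Y : C)
    (f : W ~> X) (g : W ~> Y) (h : W' ~> W) :
  pairing f g ∘ h = pairing (f ∘ h) (g ∘ h).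
Proof.
  apply pairing_unique; rewrite comp_assoc; now rewrite ?pr1_pairing, ?pr2_pairing.
Qed.

Section Algebras.
Variables (C : Category) (F : Functor C C).

Lemma is_algebra_morphism_comp (A1 A2 A3 : Algebra F) (g : A2 ~> A3)
    (f : A1 ~> A2) :
  is_algebra_morphism A2 A3 g -> is_algebra_morphism A1 A2 f ->
  is_algebra_morphism A1 A3 (g ∘ f).
Proof.
  unfold is_algebra_morphism; intros eg ef.
  now rewrite <- comp_assoc, ef, comp_assoc, eg, <- comp_assoc, <- fmap_comp.
Qed.

Lemma is_algebra_morphism_id (A : Algebra F) :
  is_algebra_morphism A A (idm (carrier A)).
Proof. unfold is_algebra_morphism; now rewrite fmap_id, comp_idl, comp_idr. Qed.

Variable star : FreeAlgebras F.

Lemma star_map_comp (X Y Z : C) (g : Y ~> Z) (f : X ~> Y) :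
  star_map star (g ∘ f) = star_map star g ∘ star_map star f.
Proof.
  symmetry; unfold star_map at 3; apply ext_unique.
  - apply (@is_algebra_morphism_comp (star X) (star Y) (star Z));
      apply ext_morphism.
  - unfold star_map, star_ob.
    now rewrite <- comp_assoc, ext_eta, comp_assoc, ext_eta, comp_assoc.
Qed.

(** Both sides are algebra morphisms on the free algebra over [A] that restrict to [h] on
    generators. *)
Lemma hat_natural (A A' : Algebra F) (h : A ~> A') :
  is_algebra_morphism A A' h -> h ∘ hat star A = hat star A' ∘ star_map star h.
Proof.
  intros Hh; transitivity (ext (star A) h).
  - apply ext_unique.
    + apply (@is_algebra_morphism_comp (star A) A A'); [exact Hh|].
      apply ext_morphism.
    + unfold hat, star_ob; now rewrite <- comp_assoc, ext_eta, comp_idr.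
  - symmetry; apply ext_unique.
    + apply (@is_algebra_morphism_comp (star A) (star A') A');
        apply ext_morphism.
    + unfold hat, star_map, star_ob.
      now rewrite <- comp_assoc, ext_eta, comp_assoc, ext_eta, comp_idl.
Qed.

Variable prodC : BinaryProducts C.

(** Reduces primitive recursion, where [r] also sees the value of [h], to ordinary recursion into an
    algebra on [A × D]. *)
Lemma primitive_recursion_morphism (T A : Algebra F) (D : C)
    (r : F (A × D) ~> D) (h : T ~> A) (g : T ~> D) :
  is_algebra_morphism T A h ->
  g ∘ structure T = r ∘ fmap F (pairing h g) ->
  is_algebra_morphism T (MkAlgebra (pairing (structure A ∘ fmap F pr1) r))
    (pairing h g).
Proof.
  unfold is_algebra_morphism; cbn [structure carrier]; intros eh eg.
  transitivity (pairing (structure A ∘ fmap F h) (r ∘ fmap F (pairing h g))).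
  - apply pairing_unique; rewrite comp_assoc;
      now rewrite ?pr1_pairing, ?pr2_pairing.
  - symmetry; apply pairing_unique; rewrite comp_assoc.
    + now rewrite pr1_pairing, <- comp_assoc, <- fmap_comp, pr1_pairing.
    + now rewrite pr2_pairing.
Qed.

Lemma initial_recursion_unique (T : InitialAlgebra F) (A : Algebra F) (D : C)
    (r : F (A × D) ~> D) (h : T ~> A) (g g' : T ~> D) :
  is_algebra_morphism T A h ->
  g ∘ structure T = r ∘ fmap F (pairing h g) ->
  g' ∘ structure T = r ∘ fmap F (pairing h g') -> g = g'.
Proof.
  intros eh eg eg'.
  rewrite <- (pr2_pairing h g), <- (pr2_pairing h g'); f_equal.
  etransitivity; [|symmetry];
    apply (fold_unique (A := MkAlgebra (pairing (structure A ∘ fmap F pr1) r)));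
    now apply primitive_recursion_morphism.
Qed.

(** The pairings with [h] are algebra morphisms into the same algebra on [A × D], so freeness leaves
    only the generators to compare. *)
Lemma free_recursion_unique (X : C) (T : FreeAlgebra F X) (A : Algebra F)
    (D : C) (r : F (A × D) ~> D) (h : T ~> A) (g g' : T ~> D) :
  is_algebra_morphism T A h ->
  g ∘ structure T = r ∘ fmap F (pairing h g) ->
  g' ∘ structure T = r ∘ fmap F (pairing h g') ->
  g ∘ eta T = g' ∘ eta T -> g = g'.
Proof.
  intros eh eg eg' e.
  rewrite <- (pr2_pairing h g), <- (pr2_pairing h g'); f_equal.
  set (P := MkAlgebra (pairing (structure A ∘ fmap F pr1) r)).
  transitivity (ext T (A := P) (pairing h g ∘ eta T)); [|symmetry];
    apply (ext_unique (A := P)); try now apply primitive_recursion_morphism.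
  - reflexivity.
  - simpl; now rewrite !pairing_comp, e.
Qed.

End Algebras.

(** * Calculations with the bifunctor, products and the codiagonal *)

Section Bifunctor.
Variables (C : Category) (B : MixedBifunctor C).

Lemma bmap_comp (X X' X'' Y Y' Y'' : C) (f : X' ~> X) (f' : X'' ~> X')
    (g : Y ~> Y') (g' : Y' ~> Y'') :
  bmap B f' g' ∘ bmap B f g = bmap B (f ∘ f') (g' ∘ g).
Proof.
  symmetry.
  exact (@fmap_comp _ _ B (X, Y) (X', Y') (X'', Y'') (f', g') (f, g)).
Qed.

Lemma bmap_monic (X X' Y Y' : C) (f : X' ~> X) (g : Y ~> Y') :
  preserves_monos B -> epic f -> monic g -> monic (bmap B f g).
Proof.
  intros HB Hf Hg; apply (HB (X, Y) (X', Y') (f, g)).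
  now apply monic_op_prod.
Qed.

End Bifunctor.

Lemma prod_map_pairing (C : Category) (prodC : BinaryProducts C)
    (W X X' Y Y' : C) (f : X ~> X') (g : Y ~> Y') (u : W ~> X) (v : W ~> Y) :
  prod_map f g ∘ pairing u v = pairing (f ∘ u) (g ∘ v).
Proof.
  unfold prod_map; rewrite pairing_comp, <- !comp_assoc.
  now rewrite pr1_pairing, pr2_pairing.
Qed.

(** Both sides are [copairing h h]. The right one applies [h] to the two summands separately,
    matching naturality of [rho] in [Y] and its dinaturality in [X]. *)
Lemma comp_codiag (C : Category) (sumC : BinaryCoproducts C) (X Y : C)
    (h : X ~> Y) :
  h ∘ codiag X = codiag Y ∘ sum_map h (idm Y) ∘ sum_map (idm X) h.
Proof.
  transitivity (copairing h h).
  - apply copairing_unique; unfold codiag;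
      now rewrite <- comp_assoc, ?copairing_inl, ?copairing_inr, comp_idr.
  - symmetry; apply copairing_unique; unfold codiag, sum_map;
      rewrite <- !comp_assoc, ?copairing_inl, ?copairing_inr, ?comp_idr.
    + now rewrite copairing_inl, comp_assoc, copairing_inl, comp_idl.
    + rewrite (comp_assoc _ inr h), copairing_inr, comp_assoc.
      now rewrite copairing_inr, comp_idl.
Qed.

(** * Comparison of the operational model with other algebras *)

(** Both sides solve one primitive recursion over the identity of [mu]: the left by naturality of
    [rho], the right by its dinaturality along the fold. *)
Lemma clubsuit_fold (C : Category) (prodC : BinaryProducts C)
    (sumC : BinaryCoproducts C) (V : C) (Sigma' : Functor C C)
    (star : FreeAlgebras (plus_functor V Sigma')) (B : MixedBifunctor C)
    (law : HOGSOSLaw prodC star B)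
    (mu : InitialAlgebra (plus_functor V Sigma'))
    (A : Algebra (plus_functor V Sigma'))
    (gamma : mu ~> bob B mu mu) (club : mu ~> bob B A A) :
  is_operational_model law gamma -> is_clubsuit law club ->
  bmap B (idm (carrier mu)) (fold mu A) ∘ gamma
  = bmap B (fold mu A) (idm (carrier A)) ∘ club.
Proof.
  unfold is_operational_model, is_clubsuit; intros Hg Hc.
  rewrite <- (fold_unique (is_algebra_morphism_id mu)) in Hg.
  pose proof (fold_morphism mu A) as Hf.
  set (c := fold mu A : carrier mu ~> carrier A) in *.
  (* [Sigma] acts as the identity on the summand [V], so the fold preserves points and dinaturality
     applies to it. *)
  assert (Hpt : c ∘ pt (pointed_algebra mu) = pt (pointed_algebra A)).
  { unfold is_algebra_morphism in Hf.
    change (c ∘ (structure mu ∘ inl) = structure A ∘ inl).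
    rewrite comp_assoc, Hf, <- comp_assoc; simpl; unfold sum_map.
    now rewrite copairing_inl, comp_idr. }
  set (h := exist _ c Hpt
    : @hom (coslice V) (pointed_algebra mu) (pointed_algebra A)).
  set (Sigma := plus_functor V Sigma') in *.
  pose (M := carrier mu : C); pose (D := carrier A : C).
  (* The objects of [C] underlying the pointed algebras are only convertible to
     [M] and [D]; the equations are restated so that rewriting sees the latter. *)
  pose (R := (fun Y => rho law (pointed_algebra mu) Y)
    : forall Y : C, Sigma (M × bob B M Y) ~> bob B M (star_ob star (M + Y))).
  pose (RA := rho law (pointed_algebra A) D
    : Sigma (D × bob B D D) ~> bob B D (star_ob star (D + D))).
  assert (Hd : bmap B (idm M) (star_map star (sum_map c (idm D))) ∘ R D
      ∘ fmap Sigma (prod_map (idm M) (bmap B c (idm D)))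
    = bmap B c (idm (star_ob star (D + D))) ∘ RA
      ∘ fmap Sigma (prod_map c (idm (bob B D D))))
    by exact (rho_dinatural law h D).
  assert (Hn : bmap B (idm M) (star_map star (sum_map (idm M) c)) ∘ R M
    = R D ∘ fmap Sigma (prod_map (idm M) (bmap B (idm M) c)))
    by exact (rho_natural law (pointed_algebra mu) c).
  assert (Hg' : gamma ∘ structure mu
    = bmap B (idm M) (hat star mu) ∘ bmap B (idm M) (star_map star (codiag M))
      ∘ R M ∘ fmap Sigma (pairing (idm M) gamma)) by exact Hg.
  assert (Hc' : club ∘ structure mu
    = bmap B (idm D) (hat star A) ∘ bmap B (idm D) (star_map star (codiag D))
      ∘ RA ∘ fmap Sigma (pairing c club)) by exact Hc.
  clear Hg Hc.
  pose (hA := hat star A : star_ob star D ~> D).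
  pose (hM := hat star mu : star_ob star M ~> M).
  assert (Hh : c ∘ hM = hA ∘ star_map star c) by exact (hat_natural star Hf).
  (* Evaluation in [A] of terms over [M + D]; it is the part of the recursion step shared by both
     sides. *)
  pose (s := hA ∘ star_map star (codiag D) ∘ star_map star (sum_map c (idm D))).
  assert (Hs : c ∘ hM ∘ star_map star (codiag M)
    = s ∘ star_map star (sum_map (idm M) c)).
  { rewrite Hh, <- comp_assoc, <- star_map_comp, comp_codiag.
    now rewrite !star_map_comp, !comp_assoc. }
  apply (@initial_recursion_unique C Sigma prodC mu mu _
    (bmap B (idm M) s ∘ R D) (idm M)); [apply is_algebra_morphism_id | |].
  - transitivity (bmap B (idm M) (c ∘ hM ∘ star_map star (codiag M)) ∘ R M
      ∘ fmap Sigma (pairing (idm M) gamma)).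
    + rewrite <- comp_assoc, Hg', !comp_assoc.
      change (hat star mu) with hM; now rewrite !bmap_comp, !comp_idl.
    + transitivity (bmap B (idm M) s
        ∘ (bmap B (idm M) (star_map star (sum_map (idm M) c)) ∘ R M)
        ∘ fmap Sigma (pairing (idm M) gamma)).
      * now rewrite Hs, comp_assoc, bmap_comp, comp_idl.
      * rewrite Hn, <- !comp_assoc, <- (fmap_comp Sigma), prod_map_pairing.
        now rewrite comp_idl.
  - transitivity (bmap B (idm M) (hA ∘ star_map star (codiag D))
      ∘ (bmap B c (idm (star_ob star (D + D))) ∘ RA
        ∘ fmap Sigma (prod_map c (idm (bob B D D))))
      ∘ fmap Sigma (pairing (idm M) club)).
    + rewrite <- !comp_assoc, <- (fmap_comp Sigma), prod_map_pairing.
      rewrite comp_idl, comp_idr, Hc', !comp_assoc.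
      change (hat star A) with hA; now rewrite !bmap_comp, !comp_idl, !comp_idr.
    + rewrite <- Hd; unfold s.
      rewrite <- !comp_assoc, <- (fmap_comp Sigma), prod_map_pairing.
      now rewrite !comp_idl, !comp_assoc, bmap_comp, comp_idl.
Qed.

(** * Congruence of the behavioural kernel pair *)

Theorem theorem4p12
  (C : Category) (prodC : BinaryProducts C) (sumC : BinaryCoproducts C)
  (C_regular : regular_category C)
  (C_limits : has_finite_limits C) (C_colimits : has_finite_colimits C)
  (V : C) (Sigma' : Functor C C)
  (Sigma'_free : admits_free_algebras Sigma')
  (star : FreeAlgebras (plus_functor V Sigma'))
  (mu : InitialAlgebra (plus_functor V Sigma'))
  (B : Functor (prod_cat (op C) C) C)
  (law : HOGSOSLaw prodC star B)
  (Sigma_coeq : preserves_reflexive_coequalizers (plus_functor V Sigma'))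
  (B_monos : preserves_monos B)
  (iota_club : mu ~> bob B mu mu)
  (iota_club_spec : is_operational_model law iota_club)
  (Z : FinalCoalgebra (fix_left B mu))
  (E : C) (p1 p2 : E ~> mu)
  (E_kernel : is_kernel_pair (coit Z iota_club) p1 p2) :
  is_congruence p1 p2.
Proof.
  set (Sigma := plus_functor V Sigma') in *.
  set (f := coit Z iota_club) in *.
  assert (Hf : final_str Z ∘ f = bmap B (idm (carrier mu)) f ∘ iota_club)
    by exact (coit_morphism Z iota_club).
  destruct (kernel_pair_reflexive E_kernel) as (s & s1 & s2).
  destruct (regular_coequalizers C_regular E_kernel) as (Q & q & Hq).
  pose proof (proj1 E_kernel) as fp.
  (* [f] splits as the regular epi [q] followed by [m], which is monic. *)
  destruct (proj2 Hq _ f fp) as (m & em & _).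
  pose proof (kernel_quotient_monic C_regular E_kernel Hq em) as m_monic.
  set (T := star E).
  set (r1 := ext T p1); set (r2 := ext T p2).
  assert (Hr1 : r1 ∘ structure T = structure mu ∘ fmap Sigma r1)
    by exact (ext_morphism T p1).
  assert (Hr2 : r2 ∘ structure T = structure mu ∘ fmap Sigma r2)
    by exact (ext_morphism T p2).
  assert (e1 : r1 ∘ eta T = p1) by apply ext_eta.
  assert (e2 : r2 ∘ eta T = p2) by apply ext_eta.
  destruct (coequalizer_exists r1 r2 C_colimits) as (A0 & c & Hc).
  assert (r_refl : reflexive_pair r1 r2).
  { exists (eta T ∘ s); now rewrite !comp_assoc, e1, e2. }
  pose proof (proj1 Hc) as cr.
  (* [fmap Sigma c] is again a coequalizer, and [c ∘ structure mu] descends along it because [r1]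
     and [r2] are algebra morphisms. *)
  destruct (proj2 (Sigma_coeq _ _ _ _ _ _ r_refl Hc) _ (c ∘ structure mu))
    as (a & ea & _).
  { now rewrite <- !comp_assoc, <- Hr1, <- Hr2, !comp_assoc, cr. }
  set (A := @MkAlgebra C Sigma A0 a).
  assert (Hcm : is_algebra_morphism mu A c) by (symmetry; exact ea).
  pose proof (fold_unique Hcm) as c_fold.
  (* Two facts about the clubsuit morphism of [A] are retained: its compatibility with [iota_club]
     and the shape of its recursion, with the law hidden in [r]. *)
  assert (Hclub : exists (k : mu ~> bob B A0 A0)
      (r : Sigma (A0 × bob B A0 A0) ~> bob B A0 A0),
      bmap B (idm (carrier mu)) c ∘ iota_club = bmap B c (idm A0) ∘ k /\
      k ∘ structure mu = r ∘ fmap Sigma (pairing c k)).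
  { destruct (clubsuit_exists_unique law mu A) as (k & Hk & _).
    exists k, (bmap B (idm A0) (hat star A)
      ∘ bmap B (idm A0) (star_map star (codiag A0))
      ∘ rho law (pointed_algebra A) A0).
    rewrite c_fold; split; [exact (clubsuit_fold iota_club_spec Hk) | exact Hk]. }
  destruct Hclub as (club & r & lax & Hclub).
  assert (cp : c ∘ p1 = c ∘ p2) by now rewrite <- e1, <- e2, !comp_assoc, cr.
  destruct (proj2 Hq _ c cp) as (c' & ec & _).
  (* After composition with the monic [B(id,m)], each side becomes [final_str Z ∘ f] after a
     projection, and [f] identifies the projections. *)
  assert (Bq : bmap B (idm (carrier mu)) q ∘ iota_club ∘ p1
      = bmap B (idm (carrier mu)) q ∘ iota_club ∘ p2).
  { apply (bmap_monic (f := idm (carrier mu)) B_monos (g := m)).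
    - intros W u v; now rewrite !comp_idr.
    - exact m_monic.
    - rewrite !comp_assoc, bmap_comp, em, comp_idl, <- Hf.
      now rewrite <- !comp_assoc, fp. }
  (* Under the monic [B(c,id)], [club] becomes [B(id,c) ∘ iota_club], which factors through
     [B(id,q) ∘ iota_club] since [c = c' ∘ q]. *)
  assert (club_p : club ∘ p1 = club ∘ p2).
  { apply (bmap_monic (f := c) (g := idm A0) B_monos (coequalizer_epic Hc)).
    - intros W u v; now rewrite !comp_idl.
    - rewrite !comp_assoc, <- lax, <- ec.
      rewrite <- (comp_idl (idm (carrier mu))), <- bmap_comp.
      now rewrite <- !comp_assoc, (comp_assoc _ iota_club p1), Bq, !comp_assoc. }
  (* Both sides obey the same recursion over [c ∘ r1 = c ∘ r2], and agree on generators by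
     [club_p]. *)
  assert (club_r : club ∘ r1 = club ∘ r2).
  { apply (@free_recursion_unique C Sigma prodC E T A _ r (c ∘ r1)).
    - apply (@is_algebra_morphism_comp C Sigma T mu A); [exact Hcm | exact Hr1].
    - rewrite <- comp_assoc, Hr1, comp_assoc, Hclub, <- comp_assoc.
      rewrite <- (fmap_comp Sigma), pairing_comp; reflexivity.
    - rewrite <- comp_assoc, Hr2, comp_assoc, Hclub, <- comp_assoc.
      rewrite <- (fmap_comp Sigma), pairing_comp, cr; reflexivity.
    - now rewrite <- !comp_assoc, e1, e2. }
  destruct (proj2 Hc _ (bmap B (idm (carrier mu)) c ∘ iota_club))
    as (alpha & Halpha & _).
  { now rewrite lax, <- !comp_assoc, club_r. }
  (* [c] is a coalgebra morphism from the operational model to [alpha], so finality identifies the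
     composite with [f]. *)
  assert (f_fac : f = coit Z (alpha : A0 ~> fix_left B mu A0) ∘ c).
  { symmetry; apply (coit_unique (F := fix_left B mu)).
    pose proof (coit_morphism Z (alpha : A0 ~> fix_left B mu A0)) as Hk.
    unfold is_coalgebra_morphism in *; simpl in *.
    rewrite comp_assoc, Hk, <- comp_assoc, Halpha, comp_assoc, bmap_comp.
    now rewrite comp_idl. }
  (* Applying an operation to projected elements of [E] is the same as forming the term in [T] and
     then applying the extended projection. *)
  assert (i1 : forall (p : E ~> mu) (t : T ~> mu), t ∘ eta T = p ->
      t ∘ structure T = structure mu ∘ fmap Sigma t ->
      structure mu ∘ fmap Sigma p
      = t ∘ structure T ∘ fmap Sigma (eta T)).
  { intros p t <- Hr; now rewrite Hr, (fmap_comp Sigma), comp_assoc. }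
  (* The mediating [u] is an algebra structure on [E] for which both projections are algebra
     morphisms; hence [q ∘ structure mu] descends to [Q]. *)
  destruct (proj2 E_kernel _ (structure mu ∘ fmap Sigma p1)
    (structure mu ∘ fmap Sigma p2)) as (u & [u1 u2] & _).
  { rewrite (i1 _ _ e1 Hr1), (i1 _ _ e2 Hr2), f_fac.
    rewrite <- !comp_assoc, (comp_assoc c r1), cr; now rewrite !comp_assoc. }
  exists Q, q; split; [exact Hq|].
  assert (p_refl : reflexive_pair p1 p2) by now exists s.
  destruct (proj2 (Sigma_coeq _ _ _ _ _ _ p_refl Hq) _ (q ∘ structure mu))
    as (b & eb & _).
  - now rewrite <- !comp_assoc, <- u1, <- u2, !comp_assoc, (proj1 Hq).
  - exists b; symmetry; exact eb.
Qed.
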